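(* Let $\mathcal{B}$ be a bounding family on $[n]^d$, $\mathcal{P}=\mathcal{P}(\mathcal{B})$, and $\mathcal{D}=\prod_{r=1}^d\mathcal{D}_r$ a product distribution on $[n]^d$. Then for every function $f:[n]^d\to\mathbb{R}$, $$\sum_{r=1}^d\mathrm{dist}^r_{\mathcal{D}}(f,\mathcal{P})\ \ge\ \frac{\mathrm{dist}_{\mathcal{D}}(f,\mathcal{P})}{4}.$$
   Context: A bounding family is a tuple of $2d$ functions $l_1,u_1,\dots,l_d,u_d:[n-1]\to\mathbb{R}$ with $l_r(y)<u_r(y)$. $\mathcal{P}(\mathcal{B})$ is the set of $f:[n]^d\to\mathbb{R}$ with $l_r(x_r)\le f(x+\mathbf{e}_r)-f(x)\le u_r(x_r)$ for all $r$ and $x$ with $x_r<n$. $\mathrm{dist}_{\mathcal{D}}(f,\mathcal{P})=\inf_{g\in\mathcal{P}}\Pr_{x\sim\mathcal{D}}[f(x)\ne g(x)]$. An $r$-line is a set $\{x\in[n]^d: x_j=a_j\ \forall j\ne r\}$ for fixed $(a_j)_{j\ne r}$; the distribution $\mathcal{D}_{-r}=\prod_{i\ne r}\mathcal{D}_i$ is thus a distribution on $r$-lines. For an $r$-line $\ell$, $f|_\ell:[n]\to\mathbb{R}$ is the restriction, and $\mathrm{dist}_{\mathcal{D}_r}(f|_\ell,\mathcal{P})$ is its distance (w.r.t. $\mathcal{D}_r$) to the one-dimensional property $\{g:[n]\to\mathbb{R}: l_r(t)\le g(t+1)-g(t)\le u_r(t)\ \forall t\in[n-1]\}$. Define $\mathrm{dist}^r_{\mathcal{D}}(f,\mathcal{P})=\mathbb{E}_{\ell\sim\mathcal{D}_{-r}}[\mathrm{dist}_{\mathcal{D}_r}(f|_\ell,\mathcal{P})]$.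 *)

(* Defs.v *)
From HB Require Import structures.
From mathcomp Require Import all_boot all_order all_algebra.
From mathcomp Require Import classical_sets reals.
Set Implicit Arguments. Unset Strict Implicit. Unset Printing Implicit Defensive.
Import Order.TTheory GRing.Theory Num.Theory.
Local Open Scope ring_scope.
Local Open Scope classical_set_scope.

(* Conventions: [n] = {1,...,n} is represented by 'I_n = {0,...,n-1};
   coordinates [d] by 'I_d.  A point of [n]^d is pt d n = {ffun 'I_d -> 'I_n}.
   The bounding functions l r, u r : nat -> R are indexed 0-based: l r t bounds
   the step from coordinate value t to t+1 (t < n-1), i.e. l_r(t+1) in the
   paper's 1-based indexing.  A distribution on 'I_n is D : 'I_n -> R,
   nonnegative with total mass 1. *)

Definition pt (d n : nat) := {ffun 'I_d -> 'I_n}.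

Section Defs.
Variables (R : realType) (d n : nat).

Definition in_P (l u : 'I_d -> nat -> R) (f : pt d n -> R) : Prop :=
  forall (r : 'I_d) (x y : pt d n),
    (forall j : 'I_d, j != r -> x j = y j) ->
    (y r : nat) = (x r).+1 ->
    l r (x r) <= f y - f x <= u r (x r).

Definition in_P1 (l u : 'I_d -> nat -> R) (r : 'I_d) (g : 'I_n -> R) : Prop :=
  forall s t : 'I_n, (t : nat) = s.+1 -> l r s <= g t - g s <= u r s.

Definition prodD (D : 'I_d -> 'I_n -> R) (x : pt d n) : R :=
  \prod_(r < d) D r (x r).

Definition distP (l u : 'I_d -> nat -> R) (D : 'I_d -> 'I_n -> R)
  (f : pt d n -> R) : R :=
  inf [set (\sum_(x : pt d n | f x != g x) prodD D x) | g in in_P l u].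

Definition distP1 (l u : 'I_d -> nat -> R) (r : 'I_d) (Dr : 'I_n -> R)
  (h : 'I_n -> R) : R :=
  inf [set (\sum_(t : 'I_n | h t != g t) Dr t) | g in in_P1 l u r].

Definition line (r : 'I_d) := {ffun {j : 'I_d | j != r} -> 'I_n}.

Definition line_pt (r : 'I_d) (a : line r) (t : 'I_n) : pt d n :=
  [ffun j => if insub j is Some j' then a j' else t].

Definition restr (r : 'I_d) (f : pt d n -> R) (a : line r) : 'I_n -> R :=
  fun t => f (line_pt a t).

Definition prodD_minus (D : 'I_d -> 'I_n -> R) (r : 'I_d) (a : line r) : R :=
  \prod_(j : {j : 'I_d | j != r}) D (val j) (a j).

Definition distr (l u : 'I_d -> nat -> R) (D : 'I_d -> 'I_n -> R)
  (r : 'I_d) (f : pt d n -> R) : R :=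
  \sum_(a : line r) prodD_minus D a * distP1 l u r (D r) (restr f a).

End Defs.

(* Main.v *)
Require Import Defs.
From HB Require Import structures.
From mathcomp Require Import all_boot all_order all_algebra.
From mathcomp Require Import classical_sets reals.
From mathcomp Require Import perm boolp topology normedtype derive lra.
Import Order.TTheory GRing.Theory Num.Theory.
Import numFieldNormedType.Exports.
Local Open Scope ring_scope.
Local Open Scope classical_set_scope.
Set Implicit Arguments. Unset Strict Implicit. Unset Printing Implicit Defensive.

(** For a set [s] of dimensions let [P_s] be the functions obeying the bounds
    along the dimensions in [s], let [L_s(f)] be the weighted L1 distance from
    [f] to [P_s], let [L_s^e(f)] be the same with the loss [|t|] replaced by
    [(|t| - e)^+], and put [gap_s(f) = L_s(f) - L_s^e(f)].  By linear
    programming duality, for small [e], [gap_s(f) / 2e] is the size of a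
    maximum-weight matching (of least cardinality) in the graph of violated
    pairs that differ only in [s], but no matching is needed.
    - Changing [f] on a set of measure [m] changes [gap_s] by at most [2em]:
      two near-optimal solutions are exchanged after clamping each one to
      within [e] of the other.
    - If [f] satisfies the bounds along [r], then [gap_(r::s)(f) <= gap_s(f)]:
      the pointwise least L1 minimizer in [P_s] (taken for weights that do not
      depend on the [r]-coordinate, and inside a box, so that it exists)
      inherits the bounds along [r], and it is optimal on each slice.
    - If [e] is below every nonzero [|f - g|], where [g] is an L1 minimizer
      over all dimensions, then [e * dist(f, P) <= gap(f)].
    Repairing all [r]-lines changes [f] on a set of measure [dist^r], and going
    from [f] to the repaired function and back costs [4 e dist^r] for each
    [r]. *)

(** * Systems of difference constraints and their least L1 minimizers *)

Section DifferenceSystems.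
Context {R : realType} {T : finType}.
Implicit Types (K : T -> T -> R -> Prop) (f g h lo hi W : T -> R).

(** Upper and lower bounds both take this one-sided form, whose solution set is closed under
    pointwise min, pointwise max and adding constants; clamping needs nothing more. *)
Definition solves K g := forall x y c, K x y c -> g y <= g x + c.

Definition boxed lo hi g := forall x, lo x <= g x <= hi x.

Definition cost1 W f g := \sum_x W x * `|f x - g x|.

Lemma solves_min K g h :
  solves K g -> solves K h -> solves K (fun x => Num.min (g x) (h x)).
Proof.
move=> Pg Ph x y c Kxy; have := Pg _ _ _ Kxy; have := Ph _ _ _ Kxy.
by have [] := ltrP (g x) (h x); have [] := ltrP (g y) (h y); lra.
Qed.

Lemma solves_max K g h :
  solves K g -> solves K h -> solves K (fun x => Num.max (g x) (h x)).
Proof.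
move=> Pg Ph x y c Kxy; have := Pg _ _ _ Kxy; have := Ph _ _ _ Kxy.
by have [] := ltrP (g x) (h x); have [] := ltrP (g y) (h y); lra.
Qed.

Lemma solves_shift K g (b : R) : solves K g -> solves K (fun x => g x + b).
Proof. by move=> Pg x y c /Pg; lra. Qed.

Section Minimizer.
Import ArrowAsProduct.

Let eval_continuous (x : T) : continuous (fun g : T -> R => g x).
Proof. exact: (@proj_continuous T (fun=> R) x). Qed.

Lemma solves_closed K : closed [set g | solves K g].
Proof.
rewrite (_ : mkset _ = \bigcap_(p in [set p : T * T * R | K p.1.1 p.1.2 p.2])
   [set g | 0 <= g p.1.1 + p.2 - g p.1.2]).
  apply: closed_bigI => -[[x y] c] /= _.
  have nneg_closed : closed [set z : R | 0 <= z] by exact: closed_ge.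
  apply: (@preimage_closed _ _ (fun g : T -> R => g x + c - g y) _ _ nneg_closed).
  move=> g _.
  have cx := @eval_continuous x g.
  have cy := @eval_continuous y g.
  exact: (cvgB (cvgD cx (cvg_cst c)) cy).
rewrite eqEsubset; split=> g /=.
  by move=> Pg [[x y] c] /= /Pg; lra.
by move=> Pg x y c Kxy; have := Pg (x, y, c) Kxy; rewrite /=; lra.
Qed.

Lemma boxed_compact lo hi : compact [set g | boxed lo hi g].
Proof.
have := @tychonoff T (fun=> R) (fun x => `[lo x, hi x]%classic)
  (fun x => @segment_compact R (lo x) (hi x)).
by congr compact; apply/seteqP; split=> g /= H x; have := H x;
  rewrite /= ?in_itv.
Qed.

Lemma cost1_continuous W f : continuous (cost1 W f).
Proof.
have cF (x : T) : continuous (fun g : T -> R => W x * `|f x - g x|).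
  move=> g; have cx := @eval_continuous x g.
  exact: (cvgM (cvg_cst (W x)) (cvg_norm (cvgB (cvg_cst (f x)) cx))).
have -> : cost1 W f = fun g : T -> R =>
    foldr (fun x t => W x * `|f x - g x| + t) 0 (index_enum T).
  by apply/funext => g; rewrite /cost1 unlock.
elim: (index_enum T) => [|x s IHs] g /=.
  exact: (@cst_continuous (T -> R) R 0 g).
exact: (cvgD (cF x g) (IHs g)).
Qed.

Lemma closed_boxed_min (C : set (T -> R)) lo hi (J : (T -> R) -> R) :
  closed C -> continuous J -> (exists2 g, C g & boxed lo hi g) ->
  exists g, [/\ C g, boxed lo hi g &
    forall h, C h -> boxed lo hi h -> J g <= J h].
Proof.
move=> clC cJ [g0 Cg0 bg0].
have cS := compact_closedI (@boxed_compact lo hi) clC.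
have S0 : ([set g | boxed lo hi g] `&` C) !=set0 by exists g0.
have [g Sg gmin] := compact_EVT_min S0 cS (continuous_subspaceT cJ).
move: Sg; rewrite inE => -[bg Cg]; exists g; split=> // h Ch bh.
by apply: gmin; rewrite inE.
Qed.

(** The cost is modular: at each point min and max only permute the values of [g] and [h], so the
    two costs keep their sum. Hence the pointwise minimum of two optima is an optimum. *)
Lemma least_minimizer K W f lo hi :
  (exists2 g, solves K g & boxed lo hi g) ->
  exists g, [/\ solves K g, boxed lo hi g &
    forall h, solves K h -> boxed lo hi h ->
      cost1 W f g <= cost1 W f h /\
      (cost1 W f h <= cost1 W f g -> forall x, g x <= h x)].
Proof.
move=> nonempty.
have [m [Pm bm m_min]] :=
  closed_boxed_min (solves_closed (K := K)) (@cost1_continuous W f) nonempty.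
have clS : closed ([set g | solves K g] `&`
                   [set g | cost1 W f g <= cost1 W f m]).
  apply: closedI; first exact: solves_closed.
  have le_closed : closed [set z : R | z <= cost1 W f m] by exact: closed_le.
  apply: (@preimage_closed _ _ (cost1 W f) _ _ le_closed) => g _;
    exact: cost1_continuous.
(* Inside the box, the distance to [lo] is the sum of the values up to a
   constant, so that its minimizer lies below every other optimum. *)
have [|g [[Pg gm] bg g_min]] :=
  @closed_boxed_min _ lo hi _ clS (@cost1_continuous (fun=> 1) lo).
  by exists m => //; split => /=.
exists g; split=> // h Ph bh; split.
  by apply: le_trans gm _; exact: m_min.
move=> hg x.
pose k x := Num.min (g x) (h x).
have Pk : solves K k by exact: solves_min.
have bk : boxed lo hi k.
  move=> z; have := bg z; have := bh z; rewrite /k.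
  by have [] := ltrP (g z) (h z); lra.
have Pk' : solves K (fun x => Num.max (g x) (h x)) by exact: solves_max.
have bk' : boxed lo hi (fun x => Num.max (g x) (h x)).
  move=> z; have := bg z; have := bh z.
  by have [] := ltrP (g z) (h z); lra.
have costk : cost1 W f k <= cost1 W f m.
  have := m_min _ Pk' bk'.
  have : cost1 W f k + cost1 W f (fun x => Num.max (g x) (h x)) =
         cost1 W f g + cost1 W f h.
    rewrite /cost1 -!big_split; apply: eq_bigr => z _ /=; rewrite /k.
    by have [] := ltrP (g z) (h z); lra.
  by move: gm hg => /=; lra.
have := g_min k (conj Pk costk) bk.
have gap z : 0 <= g z - k z.
  by rewrite /k; have [] := ltrP (g z) (h z); lra.
have -> : cost1 (fun=> 1) lo k = cost1 (fun=> 1) lo g - \sum_z (g z - k z).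
  rewrite /cost1 -sumrB; apply: eq_bigr => z _.
  have := bg z; have := bk z => lk lg.
  by rewrite !(distrC (lo z)) !ger0_norm; lra.
move=> gap_le; have gap0 : \sum_z (g z - k z) <= 0 by lra.
have : g x - k x <= 0.
  apply: le_trans gap0; rewrite (bigD1 x) //= lerDl.
  by apply: sumr_ge0 => z _; exact: gap.
by rewrite /k; have [] := ltrP (g x) (h x); lra.
Qed.

End Minimizer.

(** * Thresholded costs and the exchange of two solutions *)

Definition cost W (e : R) f g :=
  \sum_x W x * Num.max 0 (`|f x - g x| - e).

Lemma cost0 W f g : cost W 0 f g = cost1 W f g.
Proof.
by apply: eq_bigr => x _; rewrite subr0 max_r.
Qed.

Definition clamp (e a b : R) := Num.max (Num.min a (b + e)) (b - e).

(** The function |t| - (|t - e| - e)^+ is t truncated to [0, 2e], hence nondecreasing; compare its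
    values at [b + e] and [a]. *)
Lemma shift_exchange (e a b : R) : 0 <= e -> b + e <= a ->
  `|b + e| + Num.max 0 (`|a - e| - e) <= `|a| + Num.max 0 (`|b| - e).
Proof.
move=> e0 ab.
have a1 := ler_norm a; have a2 := ler_norm (- a); rewrite normrN in a2.
have b1 := ler_norm b; have b2 := ler_norm (- b); rewrite normrN in b2.
have [m0 m1] : 0 <= Num.max 0 (`|b| - e) /\ `|b| - e <= Num.max 0 (`|b| - e).
  by rewrite !le_max !lexx orbT.
have [|] := ltrP 0 (`|a - e| - e);
  by have [|] := ger0P (b + e); have [|] := ger0P (a - e); lra.
Qed.

(** If [a] and [b] are closer than [e], nothing moves. Otherwise the two values trade places up to a
    shift by [e] towards each other, which is [shift_exchange], possibly after a reflection. *)
Lemma clamp_exchange (e a b c : R) : 0 <= e ->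
  `|c - clamp e a b| + Num.max 0 (`|c - clamp e b a| - e) <=
  `|c - a| + Num.max 0 (`|c - b| - e).
Proof.
move=> e0; rewrite /clamp.
have [ab|ab] := ltrP a (b + e); have [ba|ba] := ltrP b (a + e).
- by rewrite (@max_l _ _ a) ?(@max_l _ _ b) //; lra.
- rewrite (@max_r _ _ a) ?(@max_l _ _ (a + e)); try lra.
  have := @shift_exchange e (c - a) (c - b) e0.
  have -> : c - b + e = c - (b - e) by lra.
  have -> : c - a - e = c - (a + e) by lra.
  by apply; lra.
- rewrite (@max_l _ _ (b + e)) ?(@max_r _ _ b); try lra.
  have := @shift_exchange e (a - c) (b - c) e0.
  have -> : b - c + e = b + e - c by lra.
  have -> : a - c - e = a - e - c by lra.
  by rewrite !(distrC _ c); apply; lra.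
- have -> : e = 0 by lra.
  have -> : a = b by lra.
  by rewrite !addr0 !subr0 maxxx.
Qed.

Lemma clamp_le (e a b : R) : 0 <= e -> `|clamp e a b - b| <= e.
Proof.
move=> e0; rewrite ler_distl /clamp.
have [|] := ltrP a (b + e) => ?.
  by have [|] := ltrP a (b - e); lra.
by rewrite max_l; lra.
Qed.

Lemma solves_clamp K e g h :
  solves K g -> solves K h -> solves K (fun x => clamp e (g x) (h x)).
Proof.
move=> Pg Ph; apply: solves_max; last exact: (solves_shift (- e) Ph).
by apply: solves_min => //; exact: (solves_shift e Ph).
Qed.

Lemma cost_exchange K W e f f' g h :
  0 <= e -> (forall x, 0 <= W x) -> solves K g -> solves K h ->
  exists g' h', [/\ solves K g', solves K h' &
    cost W 0 f g' + cost W e f' h' <=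
    cost W 0 f' g + cost W e f h + 2 * e * \sum_(x | f x != f' x) W x].
Proof.
move=> e0 W0 Pg Ph.
exists (fun x => clamp e (g x) (h x)), (fun x => clamp e (h x) (g x)).
split; try exact: solves_clamp.
rewrite !cost0 /cost1 /cost mulr_sumr (big_mkcond (fun x => f x != f' x)).
rewrite -!big_split; apply: ler_sum => x _ /=; rewrite -!mulrDr.
case: ifPn => [_|]; last first.
  rewrite negbK addr0 => /eqP ->; apply: ler_wpM2l => //; exact: clamp_exchange.
(* Where [f] and [f'] differ, [g] clamped to [h] costs at most |f - h| + e <= (|f - h| - e)^+ + 2e,
   and [h] clamped to [g] has thresholded cost at most |f' - g|. *)
rewrite (mulrC (2 * e)) -mulrDr; apply: ler_wpM2l => //.
have := clamp_le (g x) (h x) e0; have := clamp_le (h x) (g x) e0.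
have := ler_distD (g x) (f' x) (clamp e (h x) (g x)).
have := ler_distD (h x) (f x) (clamp e (g x) (h x)).
rewrite (distrC (g x)) (distrC (h x)).
have [_ m1] : 0 <= Num.max 0 (`|f x - h x| - e) /\
             `|f x - h x| - e <= Num.max 0 (`|f x - h x| - e).
  by rewrite !le_max !lexx orbT.
have := normr_ge0 (f' x - g x).
by have [|] := ltrP 0 (`|f' x - clamp e (h x) (g x)| - e); lra.
Qed.

End DifferenceSystems.

(** * The gap between the plain and the thresholded optimum *)

Section Gap.
Context {R : realType} {T : finType}.
Variables (W : T -> R) (e : R).
Hypotheses (W_ge0 : forall x, 0 <= W x) (e_ge0 : 0 <= e).
Implicit Types (K : T -> T -> R -> Prop) (f g h : T -> R).

Lemma cost_ge0 e' f g : 0 <= cost W e' f g.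
Proof. by apply: sumr_ge0 => x _; rewrite mulr_ge0 // le_max lexx. Qed.

Definition mincost K e' f := inf [set cost W e' f g | g in solves K].

Lemma mincost_le K e' f g : solves K g -> mincost K e' f <= cost W e' f g.
Proof.
move=> Pg; apply: ge_inf; last by exists g.
by exists 0 => _ [h _ <-]; exact: cost_ge0.
Qed.

(** The solution [g0] ensures nonemptiness, since [inf] of the empty set is a default value. *)
Lemma le_mincost K e' f g0 c : solves K g0 ->
  (forall g, solves K g -> c <= cost W e' f g) -> c <= mincost K e' f.
Proof.
move=> Pg0 cle; apply: lb_le_inf; first by exists (cost W e' f g0), g0.
by move=> _ [g Pg <-]; exact: cle.
Qed.

Definition gap K f := mincost K 0 f - mincost K e f.

Lemma gap_change K f f' g0 : solves K g0 ->
  gap K f <= gap K f' + 2 * e * \sum_(x | f x != f' x) W x.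
Proof.
move=> Pg0; rewrite /gap; set s := \sum_(x | _) _.
(* Each [suff] isolates one infimum on the right, which is then replaced by the cost of an arbitrary
   solution: first [g] for [f'], then [h] for [f]. *)
suff : mincost K 0 f + mincost K e f' - 2 * e * s - mincost K e f <=
       mincost K 0 f' by lra.
apply: (le_mincost Pg0) => g Pg.
suff : mincost K 0 f + mincost K e f' - 2 * e * s - cost W 0 f' g <=
       mincost K e f by lra.
apply: (le_mincost Pg0) => h Ph.
have [g' [h' [Pg' Ph']]] := cost_exchange f f' e_ge0 W_ge0 Pg Ph.
have := mincost_le 0 f Pg'; have := mincost_le e f' Ph'.
by rewrite -/s; lra.
Qed.

Lemma gap_unconstrained K f : (forall g, solves K g) -> gap K f <= 0.
Proof.
move=> all; have le0 : 0 <= mincost K e f.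
  by apply: (le_mincost (all f)) => g _; exact: cost_ge0.
have := mincost_le 0 f (all f); rewrite cost0 /cost1 big1 /gap; first lra.
by move=> x _; rewrite subrr normr0 mulr0.
Qed.

(** The threshold saves exactly [e] at each point where [f] and [g] differ. As [g] is optimal
    without the threshold and merely a candidate with it, the gap is at least this saving. *)
Lemma gap_ge_dist K f g : solves K g ->
  (forall h, solves K h -> cost1 W f g <= cost1 W f h) ->
  (forall x, f x != g x -> e <= `|f x - g x|) ->
  e * \sum_(x | f x != g x) W x <= gap K f.
Proof.
move=> Pg gmin ebound; rewrite /gap.
have : cost1 W f g <= mincost K 0 f.
  by apply: (le_mincost Pg) => h Ph; rewrite cost0; exact: gmin.
have := mincost_le e f Pg.
suff : e * \sum_(x | f x != g x) W x + cost W e f g <= cost1 W f g by lra.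
rewrite mulr_sumr big_mkcond -big_split; apply: ler_sum => x _ /=.
case: ifPn => [/ebound ex|].
  by rewrite (mulrC e) -mulrDr ler_wpM2l // max_r ?subr_ge0 // subrKC.
by rewrite negbK => /eqP ->; rewrite subrr normr0 max_l ?add0r ?oppr_le0.
Qed.
End Gap.

(** * Bounds along a list of dimensions of the grid *)

Section Grid.
Context {R : realType} {d n : nat}.
Variables (l u : 'I_d -> nat -> R).
Hypothesis l_lt_u : forall (r : 'I_d) (t : nat), (t < n.-1)%N -> l r t < u r t.
Implicit Types (s : seq 'I_d) (r : 'I_d) (x y : pt d n) (f g h lo hi : pt d n -> R).

Definition step s x y (c : R) := exists r, [/\ r \in s,
  (forall j, j != r -> x j = y j) &
  (y r = (x r).+1 :> nat) /\ c = u r (x r) \/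
  (x r = (y r).+1 :> nat) /\ c = - l r (y r)].

Lemma solves_in_P s f : (forall r, r \in s) -> solves (step s) f -> in_P l u f.
Proof.
move=> s_all Pf r x y xy yx.
have xy_le : f y <= f x + u r (x r).
  by apply: Pf; exists r; split=> //; left.
have yx_le : f x <= f y - l r (x r).
  by apply: Pf; exists r; split=> // [j /xy //|]; right.
by lra.
Qed.

Lemma solves_sub s s' f : {subset s <= s'} ->
  solves (step s') f -> solves (step s) f.
Proof.
by move=> ss' Pf x y c [r [/ss' rs xy st]]; apply: Pf; exists r.
Qed.

Lemma solves_cons r s f :
  solves (step [:: r]) f -> solves (step s) f -> solves (step (r :: s)) f.
Proof.
move=> Pr Ps x y c [r' [+ xy st]]; rewrite inE => /orP[/eqP rr'|r's].
  by apply: Pr; exists r'; split=> //; rewrite rr' mem_head.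
by apply: Ps; exists r'.
Qed.

Lemma step_lt r x y : y r = (x r).+1 :> nat -> l r (x r) < u r (x r).
Proof. by move=> yx; apply: l_lt_u; rewrite ltn_predRL -yx. Qed.

Lemma exists_solution s : exists g, solves (step s) g.
Proof.
(* All lower bounds hold with equality for this separable potential. *)
pose g x := \sum_(r < d) \sum_(0 <= t < x r) l r t.
have incr r x y : (forall j, j != r -> x j = y j) -> y r = (x r).+1 :> nat ->
    g y = g x + l r (x r).
  move=> xy yx; rewrite /g (bigD1 r) //= [X in _ = X + _](bigD1 r) //= yx.
  rewrite big_nat_recr //= addrAC; congr (_ + _ + _).
  by apply: eq_bigr => j /xy ->.
exists g => x y c [r [_ xy [[yx ->]|[yx ->]]]].
  by rewrite (incr r x y) // lerD2l ltW // (step_lt yx).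
by rewrite (incr r y x) ?addrK // => j /xy.
Qed.

Lemma exists_box s f : exists lo hi, [/\ solves (step s) lo,
  solves (step s) hi & boxed lo hi f].
Proof.
have [g Pg] := exists_solution s.
pose b := \sum_x `|f x - g x|.
exists (fun x => g x - b), (fun x => g x + b).
split; [exact: (solves_shift (- b) Pg)|exact: (solves_shift b Pg)|move=> x].
have : `|f x - g x| <= b by rewrite /b (bigD1 x) //= lerDl sumr_ge0.
by rewrite ler_distl.
Qed.

(** Truncation to a box containing [f] brings values no farther from [f], and it preserves the
    constraints because the walls satisfy them. So optimality inside the box is global. *)
Lemma solves_box s lo hi f g : solves (step s) lo -> solves (step s) hi ->
  boxed lo hi f -> solves (step s) g ->
  exists g', [/\ solves (step s) g', boxed lo hi g' &
    forall x, `|f x - g' x| <= `|f x - g x|].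
Proof.
move=> Plo Phi bf Pg.
exists (fun x => Num.min (Num.max (g x) (lo x)) (hi x)).
split; first by apply: solves_min => //; exact: solves_max.
  move=> x; have := bf x.
  by have [|] := ltrP (g x) (lo x) => ?; have [|] := ltrP _ (hi x); lra.
move=> x; have := bf x.
have [|] := ltrP (g x) (lo x) => ? ?.
  rewrite min_l; last lra.
  by have [|] := ger0P (f x - g x); have [|] := ger0P (f x - lo x); lra.
have [|] := ltrP (g x) (hi x) => ?; first exact: lexx.
by have [|] := ger0P (f x - g x); have [|] := ger0P (f x - hi x); lra.
Qed.

(** * Adding one dimension [r] to the list [s] *)

Section Line.
Variables (s : seq 'I_d) (r : 'I_d).
Hypothesis r_notin_s : r \notin s.

Lemma step_same x y c : step s x y c -> x r = y r.
Proof.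
move=> [r' [r's xy _]]; apply: xy.
by apply: contra r_notin_s => /eqP ->.
Qed.

(** Steps along [s] keep the [r]-coordinate, so the slices of constant [r]-coordinate do not
    interact and solutions can be glued along them. *)
Lemma solves_slicewise (p : pred 'I_n) g h :
  solves (step s) g -> solves (step s) h ->
  solves (step s) (fun x => if p (x r) then g x else h x).
Proof.
move=> Pg Ph x y c st; rewrite (step_same st).
by case: ifP => _; [exact: Pg|exact: Ph].
Qed.

Definition swap (a b : 'I_n) x : pt d n :=
  [ffun j => if j == r then tperm a b (x j) else x j].

Lemma swapK a b : involutive (swap a b).
Proof.
by move=> x; apply/ffunP => j; rewrite !ffunE; case: eqP => // _; rewrite tpermK.
Qed.

Lemma solves_swap a b g : solves (step s) g ->
  solves (step s) (fun x => g (swap a b x)).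
Proof.
move=> Pg x y c [r' [r's xy st]]; apply: Pg; exists r'.
have r'r : r' != r by apply: contra r_notin_s => /eqP <-.
split=> // [j jr'|]; first by rewrite !ffunE xy.
by rewrite !ffunE (negbTE r'r).
Qed.

Lemma step_swap a b x : x r = a -> swap a b x r = b.
Proof. by move=> xa; rewrite ffunE eqxx xa tpermL. Qed.

(** After lowering [q] and [q'] by [c], this is the rearrangement principle: the L1 distance of two
    pairs is least when both are sorted alike. *)
Lemma sort_pair (p q p' q' c : R) : q <= p + c ->
  `|p - Num.max p' (q' - c)| + `|q - Num.min q' (p' + c)| <=
  `|p - p'| + `|q - q'|.
Proof.
move=> pq; have [H|H] := ltrP p' (q' - c); last by rewrite min_l //; lra.
rewrite min_r; last lra.
have [|] := ger0P (p - (q' - c)); have [|] := ger0P (q - (p' + c));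
have := ler_norm (p - p'); have := ler_norm (- (p - p'));
have := ler_norm (q - q'); have := ler_norm (- (q - q'));
rewrite !normrN; lra.
Qed.

(** Swap-invariance of [W] gives the two points of a sorted pair equal weight; the bounds along [r]
    on [lo] and [hi] keep the sorted function in the box. *)
Lemma least_minimizer_step (W : pt d n -> R) f g lo hi :
  (forall a b x, W (swap a b x) = W x) -> (forall x, 0 <= W x) ->
  solves (step [:: r]) lo -> solves (step [:: r]) hi ->
  solves (step [:: r]) f -> solves (step s) g -> boxed lo hi g ->
  (forall h, solves (step s) h -> boxed lo hi h ->
     cost1 W f h <= cost1 W f g -> forall x, g x <= h x) ->
  solves (step [:: r]) g.
Proof.
move=> Wsw W0 Plo Phi Pf Pg bg gleast x0 y0 c st0.
have r_in : r \in [:: r] by rewrite mem_head.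
pose a := x0 r; pose b := y0 r; pose sw := swap a b.
have [ab abc] : a != b /\
    ((b = a.+1 :> nat) /\ c = u r a \/ (a = b.+1 :> nat) /\ c = - l r b).
  have [r' [+ _ +]] := st0; rewrite inE => /eqP -> H; split=> //.
  by case: H => -[H _]; rewrite -val_eqE /= /a /b H ?[_.+1 == _]eq_sym ltn_eqF.
have st x : x r = a -> step [:: r] x (sw x) c.
  move=> xa; exists r; split=> // [j /negbTE jr|].
    by rewrite ffunE jr.
  by rewrite (step_swap b xa) xa.
have swK : involutive sw by exact: swapK.
have y0E : y0 = sw x0.
  apply/ffunP => j; rewrite ffunE; case: eqP => [->|/eqP jr].
    by rewrite tpermL.
  have [r' [+ xy _]] := st0; rewrite inE => /eqP rr'.
  by rewrite xy // rr'.
(* Sorting the slices [a] and [b] up to the shift [c] does not increase the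
   cost, and leastness of [g] then yields the constraint between them. *)
pose h x := if x r == a then Num.max (g x) (g (sw x) - c)
  else if x r == b then Num.min (g x) (g (sw x) + c) else g x.
have Ph : solves (step s) h.
  have Psw := solves_swap a b Pg.
  apply: (solves_slicewise (pred1 a)).
    by apply: solves_max => //; exact: (solves_shift (- c) Psw).
  apply: (solves_slicewise (pred1 b)) => //.
  by apply: solves_min => //; exact: (solves_shift c Psw).
have bh : boxed lo hi h.
  move=> x; rewrite /h; have := bg x; have := bg (sw x).
  case: eqP => [xa|_].
    have := Phi _ _ _ (st x xa).
    by have [|] := ltrP (g x) (g (sw x) - c); lra.
  case: eqP => [xb|_]; last by lra.
  have sxa : sw x r = a by rewrite ffunE eqxx xb tpermR.
  have := Plo _ _ _ (st _ sxa); rewrite swK.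
  by have [|] := ltrP (g x) (g (sw x) + c); lra.
have costh : cost1 W f h <= cost1 W f g.
  (* Doubling and reindexing by the swap pairs each point with its partner, so [sort_pair] applies
     termwise. *)
  suff : 2 * cost1 W f h <= 2 * cost1 W f g by rewrite ler_pM2l.
  have double k : 2 * cost1 W f k =
      \sum_x W x * (`|f x - k x| + `|f (sw x) - k (sw x)|).
    rewrite mulr2n mulrDl mul1r {2}/cost1 (reindex_inj (inv_inj (swapK a b))).
    rewrite -big_split; apply: eq_bigr => x _ /=.
    by rewrite Wsw -mulrDr.
  rewrite !double; apply: ler_sum => x _; apply: ler_wpM2l => //.
  rewrite /h; case: (eqVneq (x r) a) => [xa|xa].
    rewrite (step_swap b xa) eq_sym (negbTE ab) eqxx swK.
    by apply: sort_pair; exact: Pf (st x xa).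
  case: (eqVneq (x r) b) => [xb|xb].
    have sxa : sw x r = a by rewrite ffunE eqxx xb tpermR.
    rewrite sxa eqxx swK addrC [leRHS]addrC.
    by apply: sort_pair; have := Pf _ _ _ (st _ sxa); rewrite swK.
  have -> : sw x r = x r by rewrite ffunE eqxx tpermD // eq_sym.
  by rewrite (negbTE xa) (negbTE xb).
have := gleast h Ph bh costh y0.
rewrite /h; have -> : y0 r = b by [].
rewrite eq_sym (negbTE ab) eqxx y0E swK le_min.
by case/andP.
Qed.

Variable (D : 'I_d -> 'I_n -> R).
Hypothesis D_ge0 : forall r t, 0 <= D r t.

(** The density without its [r]-factor is swap-invariant, and [prodD D] is a constant multiple of it
    on each slice. *)
Let W x := \prod_(j < d | j != r) D j (x j).

(** Replacing [g] by a competitor on a single slice shows that [g] is optimal for [W] on every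
    slice; weighting the slices by the factors [D r a] preserves this. *)
Lemma slice_minimizer f g lo hi :
  solves (step s) lo -> solves (step s) hi -> boxed lo hi f ->
  solves (step s) g -> boxed lo hi g ->
  (forall h, solves (step s) h -> boxed lo hi h ->
     cost1 W f g <= cost1 W f h) ->
  forall h, solves (step s) h ->
    cost1 (prodD D) f g <= cost1 (prodD D) f h.
Proof.
move=> Plo Phi bf Pg bg gmin h Ph.
have [k [Pk bk kh]] := solves_box Plo Phi bf Ph.
have prodDE x : prodD D x = D r (x r) * W x by rewrite /prodD (bigD1 r).
have prodD_ge0 x : 0 <= prodD D x by apply: prodr_ge0.
apply: (@le_trans _ _ (cost1 (prodD D) f k)); last first.
  by apply: ler_sum => x _; apply: ler_wpM2l.
have slice g' : cost1 (prodD D) f g' =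
    \sum_a D r a * \sum_(x : pt d n | x r == a) W x * `|f x - g' x|.
  rewrite /cost1 (partition_big (fun x : pt d n => x r) xpredT) //=.
  apply: eq_bigr => a _; rewrite mulr_sumr; apply: eq_bigr => x /eqP xa.
  by rewrite prodDE xa mulrA.
rewrite !slice; apply: ler_sum => a _; apply: ler_wpM2l => //.
have Pm := solves_slicewise (pred1 a) Pk Pg.
have bm : boxed lo hi (fun x => if pred1 a (x r) then k x else g x).
  by move=> x /=; case: ifP.
have := gmin _ Pm bm.
rewrite /cost1 (bigID (fun x : pt d n => x r == a)) /=.
rewrite [X in _ <= X -> _](bigID (fun x : pt d n => x r == a)) /=.
under [X in _ <= X + _ -> _]eq_bigr => x -> do [].
under [X in _ <= _ + X -> _]eq_bigr => x /negbTE -> do [].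
by rewrite lerD2r.
Qed.

(** The least minimizer over [s] obeys the bounds along [r], so adding them does not raise the plain
    optimum; the thresholded optimum cannot drop under more constraints. *)
Lemma gap_fine_lines e f : solves (step [:: r]) f ->
  gap (prodD D) e (step (r :: s)) f <= gap (prodD D) e (step s) f.
Proof.
move=> Pf.
have D0 x : 0 <= prodD D x by apply: prodr_ge0.
have r_sub : {subset [:: r] <= r :: s}.
  by move=> j; rewrite !inE => ->.
have s_sub : {subset s <= r :: s} by move=> j js; rewrite inE js orbT.
have [lo [hi [Plo Phi bf]]] := exists_box (r :: s) f.
have [Plo_s Phi_s] := (solves_sub s_sub Plo, solves_sub s_sub Phi).
have Wsw a b x : W (swap a b x) = W x.
  by apply: eq_bigr => j /negbTE jr; rewrite ffunE jr.
have W0 x : 0 <= W x by apply: prodr_ge0.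
have [|g [Pg bg gmin]] := @least_minimizer _ _ (step s) W f lo hi.
  by exists lo => // x; have := bf x; lra.
have Prg : solves (step [:: r]) g.
  apply: (least_minimizer_step Wsw W0 _ _ Pf Pg bg).
  - exact: solves_sub r_sub Plo.
  - exact: solves_sub r_sub Phi.
  - by move=> h Ph bh; exact: (gmin h Ph bh).2.
have Prsg := solves_cons Prg Pg.
have glob := slice_minimizer Plo_s Phi_s bf Pg bg
  (fun h Ph bh => (gmin h Ph bh).1).
have le0 : mincost (prodD D) (step (r :: s)) 0 f <=
           mincost (prodD D) (step s) 0 f.
  apply: (le_mincost Pg) => h Ph.
  by apply: le_trans (mincost_le D0 0 f Prsg) _; rewrite !cost0; exact: glob.
have lee : mincost (prodD D) (step s) e f <=
           mincost (prodD D) (step (r :: s)) e f.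
  apply: (le_mincost Prsg) => h Ph.
  by apply: mincost_le => //; exact: solves_sub s_sub Ph.
by rewrite /gap; lra.
Qed.

Lemma gap_cons e f f' : 0 <= e -> solves (step [:: r]) f' ->
  gap (prodD D) e (step (r :: s)) f <=
  gap (prodD D) e (step s) f + 4 * e * \sum_(x | f x != f' x) prodD D x.
Proof.
move=> e0 Pf'.
have D0 x : 0 <= prodD D x by apply: prodr_ge0.
have [g0 Pg0] := exists_solution (r :: s).
have [g1 Pg1] := exists_solution s.
have := gap_change D0 e0 f f' Pg0.
have := gap_change D0 e0 f' f Pg1.
rewrite (eq_bigl (fun x => f x != f' x)) => [|x]; last by rewrite eq_sym.
by have := gap_fine_lines e Pf'; lra.
Qed.

(** * Splitting the product distribution along [r]-lines, and repairing all of them *)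

Definition off_line x : line n r := [ffun j => x (val j)].

Lemma line_ptK x : line_pt (off_line x) (x r) = x.
Proof.
apply/ffunP => j; rewrite ffunE.
case: insubP => [j' _ <-|]; first by rewrite ffunE.
by rewrite negbK => /eqP ->.
Qed.

Lemma line_pt_r (a : line n r) t : line_pt a t r = t.
Proof. by rewrite ffunE insubF // eqxx. Qed.

Lemma line_pt_off (a : line n r) t (j : {j | j != r}) :
  line_pt a t (val j) = a j.
Proof. by rewrite ffunE valK. Qed.

Lemma off_lineK (a : line n r) t : off_line (line_pt a t) = a.
Proof. by apply/ffunP => j; rewrite ffunE line_pt_off. Qed.

Lemma prodD_line (a : line n r) t :
  prodD D (line_pt a t) = prodD_minus D a * D r t.
Proof.
rewrite /prodD (bigD1 r) //= line_pt_r mulrC; congr (_ * _).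
rewrite /prodD_minus (reindex_omap (val : {j | j != r} -> 'I_d) insub); last first.
  by move=> j jr; rewrite insubT.
apply: eq_big => [j|j _]; last by rewrite line_pt_off.
by rewrite valK eqxx (valP j).
Qed.

Lemma prodD_sum (F : pt d n -> R) :
  \sum_x prodD D x * F x =
  \sum_(a : line n r) prodD_minus D a * \sum_t D r t * F (line_pt a t).
Proof.
rewrite (reindex (fun p : line n r * 'I_n => @line_pt d n r p.1 p.2)) /=; last first.
  exists (fun x => (off_line x, x r)) => [[a t] _|x _] /=.
    by rewrite off_lineK line_pt_r.
  exact: line_ptK.
under [RHS]eq_bigr do rewrite mulr_sumr.
rewrite pair_bigA; apply: eq_bigr => -[a t] _ /=.
by rewrite prodD_line mulrA.
Qed.

Hypothesis D_sum1 : forall r, \sum_t D r t = 1.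

Lemma prodD_minus_sum1 : \sum_(a : line n r) prodD_minus D a = 1.
Proof.
rewrite -(bigA_distr_bigA (fun (j : {j | j != r}) t => D (val j) t)).
by rewrite big1.
Qed.

Lemma exists_line_solution : exists g : 'I_n -> R, in_P1 l u r g.
Proof.
exists (fun t => \sum_(0 <= i < t) l r i) => i j ij.
rewrite ij big_nat_recr //= addrAC subrr add0r lexx ltW // l_lt_u //.
by rewrite ltn_predRL -ij.
Qed.

(** The distance of a line is an infimum, so each line is repaired up to [eta]; the line weights sum
    to 1, so the total error is [eta] as well. *)
Lemma repair_lines f eta : 0 < eta ->
  exists2 f', solves (step [:: r]) f' &
    \sum_(x | f x != f' x) prodD D x <= distr l u D r f + eta.
Proof.
move=> eta0.
have near (a : line n r) : exists g : 'I_n -> R, in_P1 l u r g /\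
    \sum_(t | restr f a t != g t) D r t <=
    distP1 l u r (D r) (restr f a) + eta.
  have [|_ [g Pg <-] /ltW] := @inf_adherent R
    [set (\sum_(t : 'I_n | restr f a t != g t) D r t) | g in in_P1 l u r] _ eta0.
    split; first by have [g Pg] := exists_line_solution; eexists; exists g.
    by exists 0 => _ [g _ <-]; exact: sumr_ge0.
  by exists g.
have [G GP] := choice near.
exists (fun x => G (off_line x) (x r)).
  move=> x y c [r' [+ xy st]]; rewrite inE => /eqP rr'; move: xy st; rewrite {}rr'.
  move=> xy st; have -> : off_line y = off_line x.
    by apply/ffunP => j; rewrite !ffunE xy // (valP j).
  have [Px _] := GP (off_line x).
  by case: st => -[yx ->]; have := Px _ _ yx; lra.
rewrite big_mkcond.
rewrite (eq_bigr (fun x => prodD D x *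
  (f x != G (off_line x) (x r))%:R)) => [|x _]; last by rewrite mulr_natr mulrb.
rewrite prodD_sum /distr -[eta]mul1r -[in leRHS]prodD_minus_sum1.
rewrite mulr_suml -big_split; apply: ler_sum => a _ /=.
rewrite -mulrDr; apply: ler_wpM2l; first by apply: prodr_ge0.
apply: le_trans (GP a).2; rewrite [leRHS]big_mkcond; apply: ler_sum => t _.
by rewrite off_lineK line_pt_r mulr_natr mulrb.
Qed.

Lemma gap_cons_distr e f : 0 < e ->
  gap (prodD D) e (step (r :: s)) f <=
  gap (prodD D) e (step s) f + 4 * e * distr l u D r f.
Proof.
move=> e0; apply/ler_addgt0Pr => eta eta0.
have c0 : 0 < 4 * e by lra.
have [f' Pf' f'le] := repair_lines f (divr_gt0 eta0 c0).
have := gap_cons f (ltW e0) Pf'.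
have : 4 * e * \sum_(x | f x != f' x) prodD D x <=
       4 * e * (distr l u D r f + eta / (4 * e)) by rewrite ler_pM2l.
by rewrite [leRHS]mulrDr (mulrC _ (eta / _)) divfK ?lt0r_neq0 //; lra.
Qed.
End Line.

Lemma gap_le_sum_distr (D : 'I_d -> 'I_n -> R) e f s :
  (forall r t, 0 <= D r t) -> (forall r, \sum_t D r t = 1) -> 0 < e -> uniq s ->
  gap (prodD D) e (step s) f <= 4 * e * \sum_(r <- s) distr l u D r f.
Proof.
move=> D0 D1 e0; elim: s => [_|r s IHs /= /andP[rs /IHs le_s]].
  rewrite big_nil mulr0; apply: gap_unconstrained => [x|g x y c [r []//]].
  exact: prodr_ge0.
rewrite big_cons mulrDr.
by have := gap_cons_distr rs D0 D1 f e0; lra.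
Qed.
End Grid.

(** * Choice of the threshold and conclusion *)

Lemma pos_lower_bound (R : realType) (T : finType) (F : T -> R) :
  exists2 e, 0 < e & forall x, F x != 0 -> e <= `|F x|.
Proof.
(* The default 1 covers the case where [F] vanishes everywhere. *)
exists (\big[Num.min/1]_(x | F x != 0) `|F x|).
  by elim/big_ind: _ => // [a b a0 b0|x Fx]; rewrite ?lt_min ?a0 ?normr_gt0.
by move=> x Fx; rewrite (bigD1 x) //= ge_min lexx.
Qed.

Theorem theorem1p8 (R : realType) (d n : nat)
  (l u : 'I_d -> nat -> R)
  (hB : forall (r : 'I_d) (t : nat), (t < n.-1)%N -> l r t < u r t)
  (D : 'I_d -> 'I_n -> R)
  (hD0 : forall r t, 0 <= D r t)
  (hD1 : forall r, \sum_(t < n) D r t = 1)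
  (f : pt d n -> R) :
  \sum_(r < d) distr l u D r f >= distP l u D f / 4.
Proof.
have W0 x : 0 <= prodD D x by apply: prodr_ge0.
pose s := index_enum 'I_d.
have [lo [hi [Plo Phi bf]]] := exists_box hB s f.
have [|g [Pg bg gmin]] := @least_minimizer _ _ (step l u s) (prodD D) f lo hi.
  by exists lo => // x; have := bf x; lra.
(* The threshold is fixed only after [g]; both bounds on the gap are proportional to [e], which
   cancels at the end. *)
have [e e0 ebound] := pos_lower_bound (fun x => f x - g x).
have : e * \sum_(x | f x != g x) prodD D x <= gap (prodD D) e (step l u s) f.
  apply: (gap_ge_dist W0 (ltW e0) Pg) => [h Ph|x]; last first.
    by rewrite -subr_eq0; exact: ebound.
  have [k [Pk bk kh]] := solves_box Plo Phi bf Ph.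
  apply: le_trans (gmin k Pk bk).1 _.
  by apply: ler_sum => x _; exact: ler_wpM2l.
have := gap_le_sum_distr hB f hD0 hD1 e0 (index_enum_uniq _ : uniq s).
rewrite (mulrC 4) -mulrA => le1 /le_trans/(_ le1); rewrite ler_pM2l //.
suff : distP l u D f <= \sum_(x | f x != g x) prodD D x by lra.
apply: ge_inf; first by exists 0 => _ [h _ <-]; exact: sumr_ge0.
by exists g => //; apply: solves_in_P Pg => r; exact: mem_index_enum.
Qed.
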